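(* Let $\mathcal C$ be a $\mathbb Z$-graded $k$-linear category such that for all $x,y\in\mathcal C$ the graded vector space $\mathrm{Hom}^\bullet_{\mathcal C}(x,y)$ is finite-dimensional. (1) Suppose that $\mathcal C$ has an $n$-CY structure, given by isomorphisms $\Phi_{x,y}:\mathrm{Hom}^\bullet_{\mathcal C}(x,y)\to\mathrm{Hom}^\bullet_{\mathcal C}(y,x)^*[-n]$. Define degree $0$ pairings $\langle-,-\rangle:\mathrm{Hom}^\bullet_{\mathcal C}(x,y)\times\mathrm{Hom}^\bullet_{\mathcal C}(y,x)\to k[-n]$ by $$\langle f,g\rangle:=(-1)^{n|f|}\big(\Phi_{x,y}(f)[n]\big)(g),\qquad f\in\mathrm{Hom}^\bullet_{\mathcal C}(x,y),\ g\in\mathrm{Hom}^\bullet_{\mathcal C}(y,x).$$ Then these pairings are non-degenerate and satisfy the cyclic invariance condition $$\langle g\circ f,h\rangle=(-1)^{|g|(|f|+|h|)}\langle f\circ h,g\rangle$$ for all homogeneous $f\in\mathrm{Hom}^\bullet_{\mathcal C}(x,y)$, $g\in\mathrm{Hom}^\bullet_{\mathcal C}(y,z)$, $h\in\mathrm{Hom}^\bullet_{\mathcal C}(z,x)$. (2) Conversely, suppose that $\mathcal C$ has a collection of degree $0$ non-degenerate pairings $\langle-,-\rangle:\mathrm{Hom}^\bullet_{\mathcal C}(x,y)\times\mathrm{Hom}^\bullet_{\mathcal C}(y,x)\to k[-n]$ satisfying the same cyclic invariance condition. Then there exists a collection of degree $0$ bifunctorial isomorphisms of $\mathbb Z$-graded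 $k$-linear vector spaces $\Phi_{x,y}:\mathrm{Hom}^\bullet_{\mathcal C}(x,y)\to\mathrm{Hom}^\bullet_{\mathcal C}(y,x)^*[-n]$, making $\mathcal C$ an $n$-CY category.
   Context: $k$ is a field of characteristic zero; $V[j]^i=V^{i+j}$; $v[j]\in V[j]$ is the element corresponding to $v\in V$; $V^*$ is the graded linear dual. An $n$-CY structure on a $\mathbb Z$-graded $k$-linear category $\mathcal C$ with all $\mathrm{Hom}^\bullet_{\mathcal C}(x,y)$ finite-dimensional is a collection of degree $0$ bifunctorial isomorphisms of graded vector spaces $\Phi_{x,y}:\mathrm{Hom}^\bullet_{\mathcal C}(x,y)\to\mathrm{Hom}^\bullet_{\mathcal C}(y,x)^*[-n]$ for all $x,y\in\mathcal C$; then $\mathcal C$ is called an $n$-CY category. Bifunctoriality is with Koszul signs: for $f\in\mathrm{Hom}^\bullet_{\mathcal C}(x,y)$, $g\in\mathrm{Hom}^\bullet_{\mathcal C}(y,z)$ one has $\Phi_{x,z}\circ\mathrm{Hom}^\bullet_{\mathcal C}(x,g)=\big(\mathrm{Hom}^\bullet_{\mathcal C}(g,x)^*[-n]\big)\circ\Phi_{x,y}$ and $\Phi_{x,z}\circ\mathrm{Hom}^\bullet_{\mathcal C}(f,z)=\big(\mathrm{Hom}^\bullet_{\mathcal C}(z,f)^*[-n]\big)\circ\Phi_{y,z}$, where $\mathrm{Hom}^\bullet_{\mathcal C}(x,g)(f)=g\circ f$, $\mathrm{Hom}^\bullet_{\mathcal C}(f,z)(g)=(-1)^{|f||g|}g\circ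 f$ (and similarly for the other Hom maps), the dual of a degree $p$ map $T$ is $(T^*\varphi)(h)=(-1)^{p|\varphi|}\varphi(T(h))$, and $(T^*[-n])(\varphi[-n])=(T^*\varphi)[-n]$. *)

(* Defs.v *)
From HB Require Import structures.
From mathcomp Require Import all_boot all_order all_algebra.

Set Implicit Arguments.
Unset Strict Implicit.
Unset Printing Implicit Defensive.

Import GRing.Theory.
Local Open Scope ring_scope.

(* Finite-dimensional Z-graded vector spaces, presented as the total space     *)
(* V = (+)_i V^i together with its homogeneous subspaces V^i = gr V i; thus    *)
(* "v is homogeneous with |v| = i" reads v \in gr V i.  Finite-dimensionality  *)
(* is that of the vectType.  gsupp is any finite set of degrees outside which  *)
(* V^i = 0; no notion below depends on its choice.                             *)
Record gvect (k : fieldType) := GVect {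
  gcar :> vectType k;
  gr : int -> {vspace gcar};
  gsupp : seq int;
  gsupp_uniq : uniq gsupp;
  gr_out : forall i, i \notin gsupp -> gr i = 0%VS;
  gr_full : fullv = (\sum_(i <- gsupp) gr i)%VS;
  gr_direct : directv (\sum_(i <- gsupp) gr i)
}.

Lemma big_seq_ord R idx (op : R -> R -> R) (s : seq int) F :
  \big[op/idx]_(i <- s) F i = \big[op/idx]_(i < size s) F s`_i.
Proof. by rewrite (big_nth 0) big_mkord. Qed.

Section GradedSpaces.

Variable k : fieldType.
Implicit Types V W : gvect k.

Lemma gr_unique V (us vs : int -> V) :
    (forall i, us i \in gr V i) -> (forall i, vs i \in gr V i) ->
    \sum_(i <- gsupp V) us i = \sum_(i <- gsupp V) vs i ->
  forall i, us i = vs i.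
Proof.
move=> us_gr vs_gr; rewrite !big_seq_ord => eq_sum i.
have [i_in|i_out] := boolP (i \in gsupp V); last first.
  by move: (us_gr i) (vs_gr i); rewrite gr_out // !memv0 => /eqP-> /eqP->.
have := gr_direct V; rewrite directvE /= !big_seq_ord => dV.
have {}dV : directv (\sum_(j < size (gsupp V)) gr V (gsupp V)`_j).
  by rewrite directvE.
have /directv_sum_unique := dV.
move=> /(_ (fun j => us (gsupp V)`_j) (fun j => vs (gsupp V)`_j)).
rewrite eq_sum eqxx => /(_ (fun j _ => us_gr _) (fun j _ => vs_gr _)).
move=> /esym/forallP.
rewrite -index_mem in i_in.
by move=> /(_ (Ordinal i_in)) /=; rewrite nth_index -?index_mem // => /eqP.
Qed.

(* The projection of V onto V^i along the other V^j. *)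
Definition gproj V (i : int) : 'End(V) :=
  if i \in gsupp V then sumv_pi_for (gr_full V) i else 0.

Lemma gproj_mem V i v : gproj V i v \in gr V i.
Proof.
rewrite /gproj; case: ifP => _; first exact: memv_sum_pi.
by rewrite lfunE /= mem0v.
Qed.

Lemma gproj_sum V v : \sum_(i <- gsupp V) gproj V i v = v.
Proof.
rewrite -[RHS](sumv_pi_uniq_sum (gr_full V)) ?filter_uniq ?gsupp_uniq ?memvf //.
by rewrite !big_seq; apply: eq_bigr => i i_in; rewrite /gproj i_in.
Qed.

Lemma gproj_id V i j v : v \in gr V i -> gproj V j v = if j == i then v else 0.
Proof.
move=> v_gr; apply: (gr_unique (us := (gproj V)^~ v)
  (vs := fun j => if j == i then v else 0)) => [l|l|].
- exact: gproj_mem.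
- by case: eqP => [->|_] //; apply: mem0v.
rewrite gproj_sum; have [i_in|i_out] := boolP (i \in gsupp V).
  by rewrite (bigD1_seq i) ?gsupp_uniq //= eqxx big1 ?addr0 // => l /negPf->.
move: v_gr; rewrite gr_out // memv0 => /eqP->.
by rewrite big1 // => l _; case: ifP.
Qed.

(* koszul V p is the map v |-> (-1)^(p|v|) v. *)
Definition koszul V (p : int) : 'End(V) :=
  \sum_(i <- gsupp V) ((-1) ^ (p * i) : k) *: gproj V i.

Lemma koszulE V p i v :
  v \in gr V i -> koszul V p v = ((-1) ^ (p * i) : k) *: v.
Proof.
move=> v_gr; rewrite sum_lfunE -[in RHS](gproj_sum v) scaler_sumr.
apply: eq_bigr => j _; rewrite !lfunE /= (gproj_id _ v_gr).
by case: eqP => [->|_]; rewrite ?scaler0.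
Qed.

(* The shift: V[j]^i = V^(i+j), on the same total space, so that the element   *)
(* v[j] of V[j] corresponding to v is v itself, retyped by shv.                *)
Section Shift.
Variables (V : gvect k) (j : int).

Definition gshift_gr (i : int) : {vspace V} := gr V (i + j).
Definition gshift_supp : seq int := [seq i - j | i <- gsupp V].

Fact gshift_uniq : uniq gshift_supp.
Proof. by rewrite map_inj_uniq ?gsupp_uniq //; apply: addIr. Qed.

Fact gshift_out i : i \notin gshift_supp -> gshift_gr i = 0%VS.
Proof.
move=> i_out; apply: gr_out; apply: contra i_out => i_in.
by apply/mapP; exists (i + j); rewrite ?addrK.
Qed.

Fact gshift_full : fullv = (\sum_(i <- gshift_supp) gshift_gr i)%VS.
Proof.
rewrite big_map /gshift_gr gr_full.
by apply: eq_bigr => i _; rewrite subrK.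
Qed.

Fact gshift_direct : directv (\sum_(i <- gshift_supp) gshift_gr i).
Proof.
have := gr_direct V; rewrite !directvE /= !big_map /gshift_gr.
under [in X in _ -> X]eq_bigr do rewrite subrK.
by under [in X in _ -> _ == X]eq_bigr do rewrite subrK.
Qed.

Definition gshift : gvect k :=
  GVect gshift_uniq gshift_out gshift_full gshift_direct.

Definition shv (v : V) : gshift := v.

End Shift.

(* T[j] : V[j] -> W[j], v[j] |-> (T v)[j]. *)
Definition shmap V W (j : int) (T : 'Hom(V, W)) :
  'Hom(gshift V j, gshift W j) := T.

(* The ground field, concentrated in degree 0. *)
Definition gunit_gr (i : int) : {vspace k^o} := if i == 0 then fullv else 0%VS.

Fact gunit_uniq : uniq [:: 0 : int]. Proof. by []. Qed.

Fact gunit_out i : i \notin [:: 0] -> gunit_gr i = 0%VS.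
Proof. by rewrite inE /gunit_gr => /negPf->. Qed.

Fact gunit_full : fullv = (\sum_(i <- [:: 0%R]) gunit_gr i)%VS.
Proof. by rewrite big_seq1. Qed.

Fact gunit_direct : directv (\sum_(i <- [:: 0%R]) gunit_gr i).
Proof. by rewrite directvE /= !big_seq1. Qed.

Definition gunit : gvect k :=
  GVect gunit_uniq gunit_out gunit_full gunit_direct.

(* The graded dual D of V: D^i is the dual of V^(-i), a functional on V^(-i) being *)
(* extended by 0 to the other V^j; see mem_gdual.                                  *)
Section Dual.
Variable V : gvect k.

Definition precomp (T : 'End(V)) (phi : 'Hom(V, gunit)) : 'Hom(V, gunit) :=
  (phi \o T)%VF.

Fact precomp_linear T : linear (precomp T).
Proof. by move=> a u v; rewrite /precomp comp_lfunDl comp_lfunZl. Qed.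

HB.instance Definition _ T := GRing.isLinear.Build k _ _ _ (precomp T)
  (precomp_linear T).

Definition gdual_gr (i : int) : {vspace 'Hom(V, gunit)} :=
  limg (linfun (precomp (gproj V (- i)))).
Definition gdual_supp : seq int := [seq - i | i <- gsupp V].

Lemma gdual_grP i (phi : 'Hom(V, gunit)) :
  reflect (phi = (phi \o gproj V (- i))%VF) (phi \in gdual_gr i).
Proof.
apply: (iffP idP) => [/memv_imgP[psi _ ->]|->]; last first.
  by rewrite -[(_ \o _)%VF]/(precomp _ phi) -lfunE memv_img ?memvf.
rewrite lfunE /= /precomp; apply/lfunP=> v; rewrite !comp_lfunE.
by rewrite (gproj_id _ (gproj_mem (- i) v)) eqxx.
Qed.

Fact gdual_uniq : uniq gdual_supp.
Proof. by rewrite map_inj_uniq ?gsupp_uniq //; apply: oppr_inj. Qed.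

Fact gdual_out i : i \notin gdual_supp -> gdual_gr i = 0%VS.
Proof.
move=> i_out; apply/eqP; rewrite -subv0; apply/subvP=> phi /gdual_grP->.
rewrite /gproj ifN ?comp_lfun0r ?mem0v //.
by apply: contra i_out => i_in; apply/mapP; exists (- i); rewrite ?opprK.
Qed.

Fact gdual_full : fullv = (\sum_(i <- gdual_supp) gdual_gr i)%VS.
Proof.
apply/eqP; rewrite eq_sym eqEsubv subvf; apply/subvP=> phi _.
have -> : phi = \sum_(i <- gdual_supp) (phi \o gproj V (- i))%VF.
  apply/lfunP=> v; rewrite sum_lfunE big_map -[in LHS](gproj_sum v) linear_sum.
  by apply: eq_bigr => i _; rewrite opprK comp_lfunE.
rewrite !big_seq_ord.
apply: memv_sumr => i _; apply/gdual_grP/lfunP=> v.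
by rewrite !comp_lfunE (gproj_id _ (gproj_mem _ v)) eqxx.
Qed.

Fact gdual_direct : directv (\sum_(i <- gdual_supp) gdual_gr i).
Proof.
rewrite directvE /= !big_seq_ord.
have : directv (\sum_(i < size gdual_supp) gdual_gr gdual_supp`_i).
  apply/directv_sum_independent => us us_gr us0 i _; apply/lfunP => v.
  set d := gdual_supp`_i.
  have /gdual_grP-> := us_gr i isT.
  rewrite comp_lfunE lfunE /= -/d.
  have := congr1 (fun phi : 'Hom(V, gunit) => phi (gproj V (- d) v)) us0.
  rewrite /= sum_lfunE lfunE /= (bigD1 i) //= big1 ?addr0 // => j ji.
  have /gdual_grP-> := us_gr j isT.
  rewrite comp_lfunE (gproj_id _ (gproj_mem _ v)) ifN ?linear0 //.
  rewrite (inj_eq oppr_inj) /d nth_uniq ?gdual_uniq //.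
by rewrite directvE.
Qed.

Definition gdual : gvect k :=
  GVect gdual_uniq gdual_out gdual_full gdual_direct.

Lemma mem_gdual i (phi : gdual) :
  phi \in gr gdual i <->
  (forall j v, j != - i -> v \in gr V j -> (phi : 'Hom(V, gunit)) v = 0).
Proof.
split=> [/gdual_grP-> j v ji v_gr|phi0].
  by rewrite comp_lfunE (gproj_id _ v_gr) eq_sym (negPf ji) linear0.
apply/gdual_grP/lfunP=> v; rewrite comp_lfunE -[in LHS](gproj_sum v) linear_sum.
have [i_in|i_out] := boolP (- i \in gsupp V).
  rewrite (bigD1_seq (- i)) ?gsupp_uniq //= big1 ?addr0 // => j ji.
  exact: phi0 (gproj_mem _ _).
rewrite /gproj (negPf i_out) lfunE linear0 big_seq big1 // => j j_in.
apply: (phi0 j); last exact: (gproj_mem j v).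
by apply: contraNneq i_out => <-.
Qed.

End Dual.

Definition has_degree V W (p : int) (T : 'Hom(V, W)) : Prop :=
  forall i v, v \in gr V i -> T v \in gr W (i + p).

(* The dual map T' of T of degree p: (T' phi)(h) = (-1)^(p|phi|) phi (T h). *)
Section DualMap.
Variables (V W : gvect k) (p : int) (T : 'Hom(V, W)).

Definition dualmap_fun (phi : gdual W) : gdual V :=
  ((koszul (gdual W) p phi : 'Hom(W, gunit)) \o T)%VF.

Fact dualmap_linear : linear dualmap_fun.
Proof.
by move=> a u v; rewrite /dualmap_fun linearP comp_lfunDl comp_lfunZl.
Qed.

HB.instance Definition _ := GRing.isLinear.Build k _ _ _ dualmap_fun
  dualmap_linear.

Definition dualmap : 'Hom(gdual W, gdual V) := linfun dualmap_fun.

End DualMap.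

(* A degree 0 pairing V x W -> k[-n]; bilinearity is built into the type. *)
Definition gpairing (n : int) V W : Type :=
  'Hom(V, 'Hom(W, gshift gunit (- n))).

Definition pairing_degree0 n V W (b : gpairing n V W) : Prop :=
  forall i j v w, v \in gr V i -> w \in gr W j ->
    b v w \in gr (gshift gunit (- n)) (i + j).

Definition pairing_nondegenerate n V W (b : gpairing n V W) : Prop :=
  (forall v, (forall w, b v w = 0) -> v = 0) /\
  (forall w, (forall v, b v w = 0) -> w = 0).

End GradedSpaces.

(* Z-graded k-linear categories with finite-dimensional Hom(x, y); the type  *)
(* of gcomp makes composition bilinear, and gcomp g f is the composite of f    *)
(* followed by g.                                                              *)
Record gcat (k : fieldType) := GCat {
  gobj :> Type;
  ghom : gobj -> gobj -> gvect k;
  gid : forall x, ghom x x;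
  gcomp : forall x y z, 'Hom(ghom y z, 'Hom(ghom x y, ghom x z));
  gid_degree : forall x, gid x \in gr (ghom x x) 0;
  gcomp_degree : forall x y z i j (g : ghom y z) (f : ghom x y),
    g \in gr (ghom y z) j -> f \in gr (ghom x y) i ->
    gcomp x y z g f \in gr (ghom x z) (j + i);
  gcomp1l : forall x y (f : ghom x y), gcomp x y y (gid y) f = f;
  gcomp1r : forall x y (f : ghom x y), gcomp x x y f (gid x) = f;
  gcompA : forall x y z w (h : ghom z w) (g : ghom y z) (f : ghom x y),
    gcomp x z w h (gcomp x y z g f) = gcomp x y w (gcomp y z w h g) f
}.
Arguments gcomp {k} g {x y z} : rename.

Section CalabiYau.

Variables (k : fieldType) (C : gcat k) (n : int).

(* Hom(x, g) : f |-> g o f. *)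
Definition hom_post (x y z : C) (g : ghom y z) : 'Hom(ghom x y, ghom x z) :=
  gcomp C g.

(* Hom(f, z) : g |-> (-1)^(|f||g|) g o f, for f of degree p. *)
Section HomPre.
Variables (x y z : C) (p : int) (f : ghom x y).

Definition hom_pre_fun (g : ghom y z) : ghom x z :=
  gcomp C (koszul (ghom y z) p g) f.

Fact hom_pre_linear : linear hom_pre_fun.
Proof.
by move=> a u v; rewrite /hom_pre_fun !linearP add_lfunE scale_lfunE.
Qed.

HB.instance Definition _ := GRing.isLinear.Build k _ _ _ hom_pre_fun
  hom_pre_linear.

Definition hom_pre : 'Hom(ghom y z, ghom x z) := linfun hom_pre_fun.

End HomPre.

Definition cy_maps : Type :=
  forall x y : C, 'Hom(ghom x y, gshift (gdual (ghom y x)) (- n)).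

Definition bifunctorial (Phi : cy_maps) : Prop :=
  (forall (x y z : C) j (g : ghom y z), g \in gr (ghom y z) j ->
     (Phi x z \o hom_post x g)%VF =
     (shmap (- n) (dualmap j (hom_pre x j g)) \o Phi x y)%VF) /\
  (forall (x y z : C) i (f : ghom x y), f \in gr (ghom x y) i ->
     (Phi x z \o hom_pre z i f)%VF =
     (shmap (- n) (dualmap i (hom_post z f)) \o Phi y z)%VF).

Definition cy_structure (Phi : cy_maps) : Prop :=
  [/\ forall x y : C, has_degree 0 (Phi x y),
      forall x y : C, bijective (Phi x y)
    & bifunctorial Phi].

(* <f, g> = (-1)^(n|f|) (Phi f)[n] g; see cy_pairingE. *)
Section CYPairing.
Variables (Phi : cy_maps) (x y : C).

Definition cy_pairing_fun (f : ghom x y) :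
    'Hom(ghom y x, gshift (gunit k) (- n)) :=
  shv n (Phi x y (koszul (ghom x y) n f)).

Fact cy_pairing_linear : linear cy_pairing_fun.
Proof. by move=> a u v; rewrite /cy_pairing_fun /shv !linearP. Qed.

HB.instance Definition _ := GRing.isLinear.Build k _ _ _ cy_pairing_fun
  cy_pairing_linear.

Definition cy_pairing : gpairing n (ghom x y) (ghom y x) :=
  linfun cy_pairing_fun.

Lemma cy_pairingE i (f : ghom x y) (g : ghom y x) :
  f \in gr (ghom x y) i ->
  cy_pairing f g =
  ((-1) ^ (n * i) : k) *: ((shv n (Phi x y f) : 'Hom(ghom y x, gunit k)) g).
Proof.
move=> f_gr; rewrite lfunE /= /cy_pairing_fun (koszulE _ f_gr) linearZ.
exact: scale_lfunE.
Qed.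

End CYPairing.

Definition cyclic_invariant
    (b : forall x y : C, gpairing n (ghom x y) (ghom y x)) : Prop :=
  forall (x y z : C) (df dg dh : int)
    (f : ghom x y) (g : ghom y z) (h : ghom z x),
    f \in gr (ghom x y) df -> g \in gr (ghom y z) dg ->
    h \in gr (ghom z x) dh ->
    b x z (gcomp C g f) h =
    ((-1) ^ (dg * (df + dh)) : k) *: b z y (gcomp C f h) g.

End CalabiYau.

(* Main.v *)
Require Import Defs.
From mathcomp Require Import all_boot all_order all_algebra.
From mathcomp Require Import ring.
From HB Require Import structures.
Local Open Scope ring_scope.

Set Implicit Arguments.
Unset Strict Implicit.
Unset Printing Implicit Defensive.

Import GRing.Theory.

(** A family [Phi] of maps and its family of pairings [<f, g>] determine each
    other: they differ by the sign [(-1)^(n|f|)], which is the involution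
    [koszul n].  So both halves of the theorem follow from one equivalence
    ([cy_structureP]): [Phi] is a CY structure if and only if its pairings have
    degree 0, are non-degenerate and are cyclically invariant.  The three
    conditions match one by one.

    - Bijectivity is non-degeneracy, a comparison of dimensions
      ([bijective_nondegenerate]).

    - Degree 0 is degree 0, because a functional of degree [d] lives on
      elements of degree [-d] ([has_degree_pairing]).

    - Bifunctoriality is cyclic invariance.  Once the Koszul signs of the dual
      maps and of [(-1)^(n|f|)] are collected, naturality in the source says
      [<g o f, h> = <g, f o h>] ([natural_preP]), and naturality in the target
      says [<g o f, h> = (-1)^(|g|(|f| + |h|)) <f, h o g>] ([natural_postP]).
      The signs agree as polynomials in the degrees modulo 2, including the
      terms in [n].  These two rules together are equivalent to cyclic invariance
      ([cyclic_invariantP]), the bridge being graded symmetry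
      [<f, g> = (-1)^(|f||g|) <g, f>], which either side yields by inserting an
      identity morphism.

    For the converse half, the maps [b o koszul n] have the given [b] as their
    pairings ([cy_maps_of_pairingsK]). *)

(** * Signs *)

Section Signs.

Variable k : fieldType.

Lemma signzD (a b : int) : (-1) ^ a * (-1) ^ b = (-1) ^ (a + b) :> k.
Proof. by rewrite expfzDr // oppr_eq0 oner_eq0. Qed.

(** Every comparison of Koszul signs below is an instance, with [c] supplied and
    the polynomial identity left to [ring]. *)
Lemma signz_mod2 (c a b : int) : a = b + 2 * c -> (-1) ^ a = (-1) ^ b :> k.
Proof.
move=> ->; rewrite -signzD -exprz_exp.
have -> : (-1 : k) ^ (2 : int) = 1 by exact: sqrr_sign k 1%N.
by rewrite exp1rz mulr1.
Qed.

End Signs.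

(** * Perfect pairings of finite-dimensional spaces *)

Section PerfectPairings.

Variable k : fieldType.
Implicit Types V W : vectType k.

Lemma dim_functionals W : dim 'Hom(W, k^o) = dim W.
Proof. exact: muln1. Qed.

Lemma functionals_separate W (w : W) :
  (forall phi : 'Hom(W, k^o), phi w = 0) -> w = 0.
Proof.
move=> phi_w0; rewrite (coord_vbasis (memvf w)) big1 // => i _.
have := phi_w0 (linfun (coord (vbasis fullv) i : W -> k^o)).
by rewrite lfunE /= => ->; rewrite scale0r.
Qed.

Section Transpose.

Variables (V W : vectType k) (T : 'Hom(V, 'Hom(W, k^o))).

Definition eval_at (w : W) (phi : 'Hom(W, k^o)) : k^o := phi w.

Fact eval_at_linear w : linear (eval_at w).
Proof. by move=> a u v; rewrite /eval_at add_lfunE scale_lfunE. Qed.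

HB.instance Definition _ w := GRing.isLinear.Build k _ _ _ (eval_at w)
  (eval_at_linear w).

Definition transpose_fun (w : W) : 'Hom(V, k^o) :=
  (linfun (eval_at w) \o T)%VF.

Lemma transpose_funE w v : transpose_fun w v = T v w.
Proof. by rewrite comp_lfunE lfunE. Qed.

Fact transpose_linear : linear transpose_fun.
Proof.
move=> a u v; apply/lfunP=> x.
by rewrite add_lfunE scale_lfunE !transpose_funE linearP.
Qed.

HB.instance Definition _ := GRing.isLinear.Build k _ _ _ transpose_fun
  transpose_linear.

Definition transpose : 'Hom(W, 'Hom(V, k^o)) := linfun transpose_fun.

Lemma transposeE w v : transpose w v = T v w.
Proof. by rewrite [transpose w]lfunE transpose_funE. Qed.

End Transpose.

Lemma lker0_dim V W (T : 'Hom(V, W)) : lker T == 0%VS -> (dim V <= dim W)%N.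
Proof.
move=> /eqP T0; rewrite -!dimvf -(limg_dim_eq (f := T) (U := fullv)).
  exact: dimvS (subvf _).
by rewrite T0 capv0.
Qed.

Lemma lker0_bij V W (T : 'Hom(V, W)) :
  lker T == 0%VS -> (dim W <= dim V)%N -> bijective T.
Proof.
move=> T0 leWV; exists (T^-1)%VF; first exact: lker0_lfunK.
move=> w; apply: limg_lfunVK.
suff /eqP-> : limg T == fullv by apply: memvf.
rewrite eqEdim subvf limg_dim_eq ?(eqP T0) ?capv0 //.
by move: leWV; rewrite -!dimvf.
Qed.

Lemma lker0_kernel V W (T : 'Hom(V, W)) :
  lker T == 0%VS <-> forall v, T v = 0 -> v = 0.
Proof.
split=> [/lker0P T_inj v Tv0|T0]; first by apply: T_inj; rewrite linear0.
by apply/lker0P => u v /eqP; rewrite -subr_eq0 -linearB => /eqP/T0/subr0_eq.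
Qed.

(** Injectivity of [T] and of its transpose bound [dim V] by [dim W] and
    conversely, so the injective [T] is onto.  In the other direction the right
    radical vanishes because every functional on [W] is some [T v], and
    functionals separate points. *)
Lemma bijective_nondegenerate V W (T : 'Hom(V, 'Hom(W, k^o))) :
  bijective T <->
  (forall v, (forall w, T v w = 0) -> v = 0) /\
  (forall w, (forall v, T v w = 0) -> w = 0).
Proof.
split=> [T_bij|[T_left T_right]].
  split=> [v Tv0|w Tw0].
    apply: (bij_inj T_bij); rewrite linear0.
    by apply/lfunP=> w; rewrite lfunE Tv0.
  apply: functionals_separate => phi.
  by have [T' _ T'K] := T_bij; rewrite -(T'K phi).
have T0 : lker T == 0%VS.
  apply/lker0_kernel => v Tv0; apply: T_left => w.
  by rewrite Tv0 lfunE.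
have Tt0 : lker (transpose T) == 0%VS.
  apply/lker0_kernel => w Tw0; apply: T_right => v.
  by rewrite -transposeE Tw0 lfunE.
apply: lker0_bij T0 _.
by rewrite dim_functionals -(dim_functionals V) (lker0_dim Tt0).
Qed.

End PerfectPairings.

(** * Graded spaces *)

Section Graded.

Variable k : fieldType.
Implicit Types V W : gvect k.

Lemma eq_homogeneous V (U : vectType k) (S T : 'Hom(V, U)) :
  (forall i v, v \in gr V i -> S v = T v) -> S = T.
Proof.
move=> eqST; apply/lfunP=> v; rewrite -(gproj_sum v) !linear_sum.
by apply: eq_bigr => i _; apply: eqST (gproj_mem i v).
Qed.

Lemma koszulK V p : involutive (koszul V p).
Proof.
move=> v; suff : (koszul V p \o koszul V p)%VF = \1%VF.
  by move/lfunP/(_ v); rewrite comp_lfunE id_lfunE.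
apply: eq_homogeneous => i u u_gr.
rewrite comp_lfunE id_lfunE (koszulE _ u_gr) linearZ /= (koszulE _ u_gr).
rewrite scalerA signzD (@signz_mod2 k (p * i) _ 0) ?expr0z ?scale1r //; ring.
Qed.

Lemma gr_gunit_shift n i (a : gshift (gunit k) (- n)) :
  a \in gr (gshift (gunit k) (- n)) i <-> (i != n -> a = 0).
Proof.
rewrite /= /gshift_gr /= /gunit_gr subr_eq0; case: eqP => _.
  by rewrite memvf; split.
by rewrite memv0; split=> [/eqP//|/(_ isT)->].
Qed.

(** Both sides say that [T v w = 0] unless [|v| + |w| = n]. *)
Lemma has_degree_pairing n V W (T : 'Hom(V, gshift (gdual W) (- n))) :
  has_degree 0 T <->
  pairing_degree0 (n := n) (T : 'Hom(V, 'Hom(W, gshift (gunit k) (- n)))).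
Proof.
split=> [T_deg i j v w v_gr w_gr|T_deg i v v_gr].
  apply/gr_gunit_shift => ijn.
  have /mem_gdual/(_ j w) := T_deg i v v_gr.
  apply=> //; apply: contra ijn => /eqP->; apply/eqP; ring.
apply/mem_gdual => j w ji w_gr.
have /gr_gunit_shift := T_deg i j v w v_gr w_gr.
apply; apply: contra ji => /eqP ijn; apply/eqP; rewrite -ijn; ring.
Qed.

End Graded.

(** * Cyclic invariance as two exchange rules *)

Section CalabiYau.

Variables (k : fieldType) (C : gcat k) (n : int).
Implicit Types (Phi : cy_maps C n).

Definition pairings := forall x y : C, gpairing n (ghom x y) (ghom y x).

Definition balanced (b : pairings) : Prop :=
  forall (x y z : C) (df dg dh : int)
    (f : ghom x y) (g : ghom y z) (h : ghom z x),
    f \in gr (ghom x y) df -> g \in gr (ghom y z) dg ->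
    h \in gr (ghom z x) dh ->
    b x z (gcomp C g f) h = b y z g (gcomp C f h).

Definition rotating (b : pairings) : Prop :=
  forall (x y z : C) (df dg dh : int)
    (f : ghom x y) (g : ghom y z) (h : ghom z x),
    f \in gr (ghom x y) df -> g \in gr (ghom y z) dg ->
    h \in gr (ghom z x) dh ->
    b x z (gcomp C g f) h =
    ((-1) ^ (dg * (df + dh)) : k) *: b x y f (gcomp C h g).

Definition graded_symmetric (b : pairings) : Prop :=
  forall (x y : C) (df dg : int) (f : ghom x y) (g : ghom y x),
    f \in gr (ghom x y) df -> g \in gr (ghom y x) dg ->
    b x y f g = ((-1) ^ (df * dg) : k) *: b y x g f.

(** Cyclic invariance for the triple [id], [f], [g]. *)
Lemma cyclic_symmetric b : cyclic_invariant b -> graded_symmetric b.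
Proof.
move=> b_cyc x y df dg f g f_gr g_gr.
have := b_cyc _ _ _ _ _ _ _ _ _ (gid_degree x) f_gr g_gr.
by rewrite gcomp1r gcomp1l add0r.
Qed.

(** The functional [<id, ->] plays the role of a trace: rotating [f o id] gives
    [<f, g> = (-1)^(|f||g|) <id, g o f>], and balancing [id o g] against [f]
    identifies the right-hand pairing with [<g, f>]. *)
Lemma balanced_rotating_symmetric b :
  balanced b -> rotating b -> graded_symmetric b.
Proof.
move=> b_bal b_rot x y df dg f g f_gr g_gr.
have := b_rot _ _ _ _ _ _ _ _ _ (gid_degree x) f_gr g_gr.
rewrite gcomp1r add0r => ->.
have := b_bal _ _ _ _ _ _ _ _ _ g_gr (gid_degree x) f_gr.
by rewrite gcomp1l => <-.
Qed.

(** Balancing is one cyclic step followed by symmetry, and rotation is two cyclic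
    steps followed by symmetry; conversely balancing followed by symmetry is a
    cyclic step. *)
Lemma cyclic_invariantP b : cyclic_invariant b <-> balanced b /\ rotating b.
Proof.
split=> [b_cyc|[b_bal b_rot] x y z df dg dh f g h f_gr g_gr h_gr].
  have b_sym := cyclic_symmetric b_cyc.
  split=> x y z df dg dh f g h f_gr g_gr h_gr.
    rewrite (b_cyc _ _ _ _ _ _ _ _ _ f_gr g_gr h_gr).
    by rewrite (b_sym _ _ _ _ _ _ g_gr (gcomp_degree f_gr h_gr)).
  rewrite (b_cyc _ _ _ _ _ _ _ _ _ f_gr g_gr h_gr).
  rewrite (b_cyc _ _ _ _ _ _ _ _ _ h_gr f_gr g_gr).
  rewrite (b_sym _ _ _ _ _ _ (gcomp_degree h_gr g_gr) f_gr) !scalerA !signzD.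
  congr (_ *: _); apply: (@signz_mod2 k (df * (dh + dg))); ring.
rewrite (b_bal _ _ _ _ _ _ _ _ _ f_gr g_gr h_gr).
by rewrite (balanced_rotating_symmetric b_bal b_rot
              g_gr (gcomp_degree f_gr h_gr)).
Qed.

(** * Bifunctoriality as the two exchange rules *)

(** [Phi f] with both shifts forgotten, typed as a functional so that it can be
    applied. *)
Definition cy_form Phi (x y : C) (f : ghom x y) : 'Hom(ghom y x, gunit k) :=
  Phi x y f.

Lemma cy_formE Phi x y i (f : ghom x y) (g : ghom y x) :
  f \in gr (ghom x y) i ->
  cy_form Phi f g = ((-1) ^ (n * i) : k) *: cy_pairing Phi x y f g.
Proof.
move=> f_gr; rewrite (cy_pairingE _ _ f_gr) scalerA signzD.
rewrite (@signz_mod2 k (n * i) _ 0) ?expr0z ?scale1r //; ring.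
Qed.

Section FixedFamily.

Variable Phi : cy_maps C n.
Hypothesis Phi_deg : forall x y : C, has_degree 0 (Phi x y).

Lemma cy_form_degree x y i (f : ghom x y) :
  f \in gr (ghom x y) i ->
  (cy_form Phi f : gdual (ghom y x)) \in gr (gdual (ghom y x)) (i - n).
Proof. by move=> /(Phi_deg (y := y)); rewrite addr0. Qed.

(** Two signs arise: [(-1)^(j|Phi f|)] from the dual of a map of degree [j], where
    [Phi f] has degree [i - n] in the unshifted dual, and [(-1)^(j|h|)] from
    precomposition with [g]. *)
Lemma dual_hom_preE x y z i j l
    (f : ghom x y) (g : ghom y z) (h : ghom z x) :
  f \in gr (ghom x y) i -> g \in gr (ghom y z) j -> h \in gr (ghom z x) l ->
  (shmap (- n) (dualmap j (hom_pre x j g)) (Phi x y f)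
     : 'Hom(ghom z x, gunit k)) h =
  ((-1) ^ (j * (i - n) + j * l) : k) *: cy_form Phi f (gcomp C h g).
Proof.
move=> f_gr g_gr h_gr; rewrite /shmap [dualmap _ _ _]lfunE /= /dualmap_fun.
rewrite (koszulE _ (cy_form_degree f_gr)) comp_lfunE scale_lfunE.
rewrite [hom_pre _ _ _ _]lfunE /= /hom_pre_fun (koszulE _ h_gr).
by rewrite linearZ /= scale_lfunE linearZ /= scalerA signzD.
Qed.

Lemma dual_hom_postE x y z i j
    (f : ghom x y) (g : ghom y z) (h : ghom z x) :
  g \in gr (ghom y z) j ->
  (shmap (- n) (dualmap i (hom_post z f)) (Phi y z g)
     : 'Hom(ghom z x, gunit k)) h =
  ((-1) ^ (i * (j - n)) : k) *: cy_form Phi g (gcomp C f h).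
Proof.
move=> g_gr; rewrite /shmap [dualmap _ _ _]lfunE /= /dualmap_fun.
by rewrite (koszulE _ (cy_form_degree g_gr)) comp_lfunE scale_lfunE.
Qed.

(** Passing from [Phi] to pairings multiplies the two sides by
    [(-1)^(n(|f| + |g|))] and [(-1)^(n|f|)].  The quotient [(-1)^(n|g|)] cancels
    the part of the dual sign that comes from the shift of the dual by [-n]. *)
Lemma natural_postP :
  (forall (x y z : C) j (g : ghom y z), g \in gr (ghom y z) j ->
     (Phi x z \o hom_post x g)%VF =
     (shmap (- n) (dualmap j (hom_pre x j g)) \o Phi x y)%VF) <->
  rotating (cy_pairing Phi).
Proof.
have natE x y z df dg dh (f : ghom x y) (g : ghom y z) (h : ghom z x) :
    f \in gr (ghom x y) df -> g \in gr (ghom y z) dg ->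
    h \in gr (ghom z x) dh ->
    cy_form Phi (gcomp C g f) h =
      ((-1) ^ (dg * (df - n) + dg * dh) : k) *: cy_form Phi f (gcomp C h g) <->
    cy_pairing Phi x z (gcomp C g f) h =
      ((-1) ^ (dg * (df + dh)) : k) *: cy_pairing Phi x y f (gcomp C h g).
  move=> f_gr g_gr h_gr.
  rewrite (cy_formE _ _ (gcomp_degree g_gr f_gr)) (cy_formE _ _ f_gr).
  rewrite scalerA signzD.
  have -> : (-1) ^ (dg * (df - n) + dg * dh + n * df) =
            (-1) ^ (n * (dg + df)) * (-1) ^ (dg * (df + dh)) :> k.
    rewrite signzD; apply: (@signz_mod2 k (- (n * dg))); ring.
  rewrite -scalerA; split=> [|-> //].
  by apply: scalerI; rewrite expfz_neq0 // oppr_eq0 oner_eq0.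
split=> [nat x y z df dg dh f g h f_gr g_gr h_gr|rot x y z j g g_gr].
  apply/natE => //; rewrite -dual_hom_preE //.
  have := congr1 (fun T : 'Hom(_, _) => (T f : 'Hom(_, _)) h)
                 (nat x y z dg g g_gr).
  by rewrite !comp_lfunE.
apply: eq_homogeneous => i f f_gr; rewrite !comp_lfunE.
apply: eq_homogeneous => l h h_gr; rewrite (dual_hom_preE f_gr g_gr h_gr).
by apply/natE => //; apply: rot.
Qed.

(** The sign [(-1)^(|f||g|)] of precomposition meets the same sign from the dual
    map, and the remaining [(-1)^(n|f|)] is absorbed by the pairings: no sign is
    left. *)
Lemma natural_preP :
  (forall (x y z : C) i (f : ghom x y), f \in gr (ghom x y) i ->
     (Phi x z \o hom_pre z i f)%VF =
     (shmap (- n) (dualmap i (hom_post z f)) \o Phi y z)%VF) <->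
  balanced (cy_pairing Phi).
Proof.
have natE x y z df dg (f : ghom x y) (g : ghom y z) (h : ghom z x) :
    f \in gr (ghom x y) df -> g \in gr (ghom y z) dg ->
    cy_form Phi (hom_pre z df f g) h =
      ((-1) ^ (df * (dg - n)) : k) *: cy_form Phi g (gcomp C f h) <->
    cy_pairing Phi x z (gcomp C g f) h = cy_pairing Phi y z g (gcomp C f h).
  move=> f_gr g_gr.
  rewrite [hom_pre _ _ _ _]lfunE /= /hom_pre_fun (koszulE _ g_gr).
  rewrite linearZ /= scale_lfunE /cy_form linearZ /= scale_lfunE.
  rewrite -!/(cy_form _ _).
  rewrite (cy_formE _ _ (gcomp_degree g_gr f_gr)) (cy_formE _ _ g_gr).
  rewrite !scalerA !signzD.
  have -> : (-1) ^ (df * (dg - n) + n * dg) =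
            (-1) ^ (df * dg + n * (dg + df)) :> k.
    apply: (@signz_mod2 k (- (n * df))); ring.
  split=> [|-> //].
  by apply: scalerI; rewrite expfz_neq0 // oppr_eq0 oner_eq0.
split=> [nat x y z df dg dh f g h f_gr g_gr h_gr|bal x y z i f f_gr].
  apply/(natE _ _ _ _ _ _ _ _ f_gr g_gr); rewrite -dual_hom_postE //.
  have := congr1 (fun T : 'Hom(_, _) => (T g : 'Hom(_, _)) h)
                 (nat x y z df f f_gr).
  by rewrite !comp_lfunE.
apply: eq_homogeneous => j g g_gr; rewrite !comp_lfunE.
apply: eq_homogeneous => l h h_gr; rewrite (dual_hom_postE _ _ _ g_gr).
exact: (iffRL (natE _ _ _ _ _ _ _ _ f_gr g_gr)
              (bal _ _ _ _ _ _ _ _ _ f_gr g_gr h_gr)).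
Qed.

Lemma bifunctorial_cyclic :
  bifunctorial Phi <-> cyclic_invariant (cy_pairing Phi).
Proof.
rewrite cyclic_invariantP; split=> [[post pre]|[bal rot]].
  by split; [apply/natural_preP | apply/natural_postP].
by split; [apply/natural_postP | apply/natural_preP].
Qed.

End FixedFamily.

(** * Calabi-Yau structures as cyclic pairings *)

Lemma cy_pairing_degree Phi x y :
  pairing_degree0 (cy_pairing Phi x y) <-> has_degree 0 (Phi x y).
Proof.
rewrite has_degree_pairing; split=> deg i j v w v_gr w_gr.
  change (cy_form Phi v w \in gr (gshift (gunit k) (- n)) (i + j)).
  by rewrite (cy_formE _ _ v_gr) memvZ //; apply: deg.
by rewrite (cy_pairingE _ _ v_gr) memvZ //; apply: deg.
Qed.

Lemma cy_pairing_nondegenerate Phi x y :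
  pairing_nondegenerate (cy_pairing Phi x y) <-> bijective (Phi x y).
Proof.
have pairE f : cy_pairing Phi x y f = Phi x y (koszul (ghom x y) n f).
  by rewrite [LHS]lfunE.
have kosz_bij : bijective (koszul (ghom x y) n) := inv_bij (@koszulK _ _ _).
rewrite /pairing_nondegenerate.
rewrite -(bijective_nondegenerate
  (cy_pairing Phi x y : 'Hom(ghom x y, 'Hom(ghom y x, k^o)))).
split=> [b_bij|Phi_bij]; last first.
  exact: (eq_bij (bij_comp Phi_bij kosz_bij) (fsym pairE)).
apply: (eq_bij (bij_comp b_bij kosz_bij)) => f /=.
by rewrite pairE koszulK.
Qed.

Lemma cy_structureP Phi :
  cy_structure Phi <->
  [/\ forall x y : C, pairing_degree0 (cy_pairing Phi x y),
      forall x y : C, pairing_nondegenerate (cy_pairing Phi x y)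
    & cyclic_invariant (cy_pairing Phi)].
Proof.
split=> [[deg bij nat]|[deg nondeg cyc]].
  split=> [x y|x y|]; first by apply/cy_pairing_degree.
    by apply/cy_pairing_nondegenerate.
  exact/(bifunctorial_cyclic deg).
have {}deg x y : has_degree 0 (Phi x y) by apply/cy_pairing_degree.
split=> // [x y|]; first by apply/cy_pairing_nondegenerate.
exact/(bifunctorial_cyclic deg).
Qed.

Definition cy_maps_of_pairings (b : pairings) : cy_maps C n :=
  fun x y => (b x y \o koszul (ghom x y) n)%VF.

Lemma cy_maps_of_pairingsK b x y :
  cy_pairing (cy_maps_of_pairings b) x y = b x y.
Proof.
apply/lfunP=> f; rewrite [LHS]lfunE /= /cy_pairing_fun /shv.
by rewrite [LHS]comp_lfunE koszulK.
Qed.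

End CalabiYau.

Theorem propositionA2 (k : fieldType) (hk : [pchar k] =i pred0)
    (n : int) (C : gcat k) :
  (forall Phi : cy_maps C n, cy_structure Phi ->
     [/\ forall x y : C, pairing_degree0 (cy_pairing Phi x y),
         forall x y : C, pairing_nondegenerate (cy_pairing Phi x y)
       & cyclic_invariant (cy_pairing Phi)])
  /\
  (forall b : forall x y : C, gpairing n (ghom x y) (ghom y x),
     (forall x y : C, pairing_degree0 (b x y)) ->
     (forall x y : C, pairing_nondegenerate (b x y)) ->
     cyclic_invariant b ->
     exists Phi : cy_maps C n, cy_structure Phi).
Proof.
split=> [Phi /cy_structureP //|b deg nondeg cyc].
exists (cy_maps_of_pairings b); apply/cy_structureP; split=> [x y|x y|].
- by rewrite cy_maps_of_pairingsK.
- by rewrite cy_maps_of_pairingsK.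
by move=> x y z *; rewrite !cy_maps_of_pairingsK; apply: cyc.
Qed.
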